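(* Assume that $\mathbf{y}=(y_1,\dots,y_m)\in\mathbf{X}$ is the unique solution of the dual problem $$(D)\quad 0\in(\partial\mathbf{f})^{-1}(\mathbf{y})+(\operatorname{Id}-\mathbf{R})^{-1}\mathbf{y}.$$ Then: (i) For $1\le i\le m-1$, the mapping $\operatorname{Prox}_{f_{i+1}}:F_i\to F_{i+1}$ is bijective and is given by $z\mapsto z-y_{i+1}$. The mapping $\operatorname{Prox}_{f_1}:F_m\to F_1$ is bijective and is given by $z\mapsto z-y_1$. (ii) For $1\le i\le m-1$, $F_{i+1}=F_i-y_{i+1}$, and $F_1=F_m-y_1$. Consequently, each $F_i$ is a translation of $F_1$.
   Context: $X$ is a real Hilbert space, $m\in\{1,2,\dots\}$, $\mathbf{X}=X^m$ is the product Hilbert space, $\mathbf{R}(x_1,\dots,x_m)=(x_m,x_1,\dots,x_{m-1})$, $\Delta=\{(x,\dots,x):x\in X\}$, and $(\operatorname{Id}-\mathbf{R})^{-1}$ is the set-valued inverse. $f_1,\dots,f_m$ are proper lower semicontinuous convex functions $X\to\,]-\infty,+\infty]$, $\mathbf{f}(x_1,\dots,x_m)=\sum_{i=1}^m f_i(x_i)$, $\partial$ is the convex subdifferential, and $\operatorname{Prox}_{f_i}=(\operatorname{Id}+\partial f_i)^{-1}$. Standing assumption: $\operatorname{dom}\mathbf{f}^*\cap\Delta^\perp\neq\varnothing$ ($\mathbf{f}^*$ the Fenchel conjugate). For $1\le i\le m$, $F_i:=\operatorname{Fix}\big(\operatorname{Prox}_{f_i}\cdots\operatorname{Prox}_{f_1}\operatorname{Prox}_{f_m}\cdots\operatorname{Prox}_{f_{i+1}}\big)$,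 where $\operatorname{Fix}$ denotes the fixed point set (for $i=m$ the composition is $\operatorname{Prox}_{f_m}\cdots\operatorname{Prox}_{f_1}$). *)

(* Defs.v *)
From HB Require Import structures.
From mathcomp Require Import all_boot all_order all_algebra.
From mathcomp Require Import all_classical all_reals all_analysis.
Set Implicit Arguments.
Unset Strict Implicit.
Unset Printing Implicit Defensive.
Import Order.TTheory GRing.Theory Num.Theory.
Import numFieldNormedType.Exports.
Local Open Scope classical_set_scope.
Local Open Scope ring_scope.

(* A real Hilbert space is a complete normed module whose norm is the one of an
   inner product, given as a positive definite symmetric bilinear form. *)
Definition norm_of_dot (R : realType) (X : completeNormedModType R)
    (dot : {dot X for idfun}) : Prop :=
  forall x : X, `|x| = Num.sqrt (dot x x).

(* The product space X^m is {ffun 'I_m -> X}, whose i-th coordinate (1 <= i <= m)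
   is at the ordinal i - 1; only its vector space structure and the inner product
   below are needed. *)
Section product_dot.
Variables (R : realType) (X : lmodType R) (dot : {dot X for idfun}) (m : nat).

Definition prod_dot (x y : {ffun 'I_m -> X}) : R := \sum_(i < m) dot (x i) (y i).

Let prod_dotC x y : prod_dot x y = (-1) ^+ false * idfun (prod_dot y x).
Proof.
rewrite expr0 mul1r; apply: eq_bigr => i _.
by rewrite [LHS]hermitian_subproof expr0 mul1r.
Qed.

Let prod_dot_bilinear :
  bilinear_for *%R (idfun \; *%R : GRing.Scale.law R R) prod_dot.
Proof.
have linl u : linear_for *%R (prod_dot ^~ u).
  move=> a x y; rewrite /prod_dot mulr_sumr -big_split /=.
  by apply: eq_bigr => i _; rewrite !ffunE linearPl.
split=> // u a x y; have sym v : prod_dot u v = prod_dot v u.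
  by rewrite prod_dotC expr0 mul1r.
by rewrite /= !sym linl.
Qed.

HB.instance Definition _ :=
  @bilinear_isBilinear.Build R _ _ _ _ _ prod_dot prod_dot_bilinear.
HB.instance Definition _ :=
  @isHermitianSesquilinear.Build R _ false idfun prod_dot prod_dotC.

Let prod_dot_gt0 x : x != 0 -> 0 < prod_dot x x.
Proof.
move=> x_neq0; have dot_ge0 z : 0 <= dot z z.
  have [->|z_neq0] := eqVneq z 0; first by rewrite linear0r.
  exact/ltW/neq0_dnorm_gt0.
have [i xi_neq0] : exists i, x i != 0.
  apply/existsP; apply: contra_neqT x_neq0 => /existsPn x0.
  by apply/ffunP => i; rewrite ffunE; apply/eqP; rewrite -[_ == _]negbK x0.
rewrite /prod_dot (bigD1 i) //=.
apply: ltr_wpDr; first exact: sumr_ge0.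
exact: neq0_dnorm_gt0.
Qed.

HB.instance Definition _ := @isDotProduct.Build R _ prod_dot prod_dot_gt0.

End product_dot.
Arguments prod_dot {R X} dot {m} x y.

Section set_valued_operators.
Variable V : zmodType.
Implicit Types (A B : V -> set V) (C D : set V).

Definition op_of (g : V -> V) : V -> set V := fun x => [set g x].

Definition add_op A B : V -> set V := fun x => [set a + b | a in A x & b in B x].

Definition inv_op A : V -> set V := fun u => [set x | A x u].

Definition comp_op B A : V -> set V := fun x => \bigcup_(y in A x) B y.

Definition fix_op A : set V := [set x | A x x].

(* A restricts to a single-valued bijection from C onto D. *)
Definition bij_op A C D : Prop :=
  exists2 g : V -> V, (forall z, C z -> A z = [set g z]) & set_bij C D g.

Definition translate C (v : V) : set V := [set z + v | z in C].

End set_valued_operators.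

Section convex_analysis.
Variables (R : realType) (V : lmodType R).
Implicit Types (f : V -> \bar R) (dot : {dot V for idfun}).
Local Open Scope ereal_scope.

Definition edom f : set V := [set x | f x < +oo].

Definition proper_ereal f : Prop := (forall x, -oo < f x) /\ edom f !=set0.

Definition convex_ereal f : Prop :=
  forall (x y : V) (t : R), (0 < t < 1)%R ->
    f (t *: x + (1 - t) *: y)%R <= t%:E * f x + (1 - t)%:E * f y.

Definition fenchel_conjugate dot f : V -> \bar R :=
  fun u => ereal_sup (range (fun x => (dot x u)%:E - f x)).

Definition subdifferential dot f : V -> set V :=
  fun x => [set u | forall z, f x + (dot (z - x)%R u)%:E <= f z].

Definition prox dot f : V -> set V :=
  inv_op (add_op (op_of id) (subdifferential dot f)).

Definition orthogonal_compl dot (C : set V) : set V :=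
  [set u | forall x, C x -> dot x u = 0%R].

End convex_analysis.

Section cyclic.
Variables (R : realType) (X : lmodType R) (m : nat).

Definition rshift_op (x : {ffun 'I_m -> X}) : {ffun 'I_m -> X} :=
  [ffun i => x (ord_pred i)].

Definition diagonal_space : set {ffun 'I_m -> X} := range (fun x : X => [ffun=> x]).

Definition separable_sum (f : 'I_m -> X -> \bar R) (x : {ffun 'I_m -> X}) : \bar R :=
  (\sum_(i < m) f i (x i))%E.

(* Solution set of 0 \in (partial F)^-1 y + (Id - R)^-1 y. *)
Definition dual_solutions (dot : {dot X for idfun}) (f : 'I_m -> X -> \bar R) :
    set {ffun 'I_m -> X} :=
  [set y | add_op
     (inv_op (subdifferential (prod_dot dot) (separable_sum f)))
     (inv_op (op_of (fun x => x - rshift_op x))) y 0].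

(* With 0-based i, the operators are applied in the order
   i+1, ..., m-1, 0, ..., i, so Prox_{f_{i+1}} first and Prox_{f_i} last. *)
Definition cyclic_prox (dot : {dot X for idfun}) (f : 'I_m -> X -> \bar R)
    (i : 'I_m) : X -> set X :=
  foldl (fun A k => comp_op (prox dot (f k)) A) (op_of id) (rot i.+1 (enum 'I_m)).

Definition cyclic_fix (dot : {dot X for idfun}) (f : 'I_m -> X -> \bar R)
    (i : 'I_m) : set X :=
  fix_op (cyclic_prox dot f i).

End cyclic.

(* Main.v *)
Require Import Defs.
From HB Require Import structures.
From mathcomp Require Import all_boot all_order all_algebra.
From mathcomp Require Import all_classical all_reals all_analysis.
From mathcomp Require Import zify lra.
Set Implicit Arguments.
Unset Strict Implicit.
Unset Printing Implicit Defensive.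
Import Order.TTheory GRing.Theory Num.Theory.
Import numFieldNormedType.Exports.
Local Open Scope classical_set_scope.
Local Open Scope ring_scope.

(** A fixed point z of a cyclic composition of proximity operators comes with
    the whole cycle x of intermediate values: x_k is in Prox_{f_k} (x_{k-1})
    for all k in cyclic order, and z is one of the x_k (lemma [cyclic_fixP]).  By
    definition of Prox, x_{k-1} - x_k is a subgradient of f_k at x_k, so that
    R x - x is a subgradient of the separable sum at x; since moreover
    (Id - R) (- x) = R x - x, the vector R x - x solves the dual problem, with
    x and - x as the two elements that sum to 0 (lemma [cycle_dual_solution]).
    Uniqueness of the dual solution y then forces x_k = x_{k-1} - y_k along
    every cycle.  So the translation by - y_k maps each fixed point to its
    successor in its cycle, which is again a fixed point of the next
    composition, and every fixed point of the latter arises in this way.  As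
    Prox is at most single-valued, by monotonicity of the subdifferential
    (lemma [prox_unique]), this translation is Prox_{f_k} on the fixed points. *)

(** * Proximity operators and subdifferentials *)

Section prox.
Variables (R : realType) (V : lmodType R) (dot : {dot V for idfun}).

Lemma proxE (f : V -> \bar R) (z p : V) :
  prox dot f z p <-> subdifferential dot f p (z - p).
Proof.
rewrite /prox /inv_op /add_op /op_of /=; split.
  by move=> [_ -> [b bp <-]]; rewrite addrC addKr.
by move=> zp; exists p => //; exists (z - p) => //; rewrite addrC subrK.
Qed.

(** The subgradient inequality at a point where f is finite excludes the value
    +oo at x.  Finiteness is what allows the values of f to cancel when two
    subgradient inequalities are added, as in the next lemma. *)
Lemma subdifferential_fin_num (f : V -> \bar R) (x u : V) :
  proper_ereal f -> subdifferential dot f x u -> f x \is a fin_num.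
Proof.
move=> [f_gtNy [z fz_lty]] fxu; rewrite fin_numElt f_gtNy /=.
have := le_lt_trans (fxu z) fz_lty.
by move: (f_gtNy x); case: (f x).
Qed.

Lemma subdifferential_monotone (f : V -> \bar R) (x x' u u' : V) :
  proper_ereal f -> subdifferential dot f x u -> subdifferential dot f x' u' ->
  0 <= dot (x - x') (u - u').
Proof.
move=> f_proper fxu fxu'.
have fx := subdifferential_fin_num f_proper fxu.
have fx' := subdifferential_fin_num f_proper fxu'.
move: (fxu x') (fxu' x); rewrite -(fineK fx) -(fineK fx') -!EFinD !lee_fin.
rewrite -(opprB x x') linearNl linearBr /=; lra.
Qed.

(** If p and q are both proximal points of z, monotonicity reads
    0 <= - |p - q|^2. *)
Lemma prox_unique (f : V -> \bar R) (z p q : V) :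
  proper_ereal f -> prox dot f z p -> prox dot f z q -> p = q.
Proof.
move=> f_proper /proxE zp /proxE zq.
have := subdifferential_monotone f_proper zp zq.
have -> : z - p - (z - q) = - (p - q).
  by rewrite opprB [LHS]addrC subrKA opprB.
rewrite linearNr /= oppr_ge0 => pq_le0.
apply/eqP; rewrite -subr_eq0; apply: contraLR pq_le0 => /neq0_dnorm_gt0.
by rewrite -ltNge; apply.
Qed.

End prox.

(** The subgradient inequalities of the summands add up; this is how a cycle,
    which satisfies one inclusion per summand, produces a dual solution. *)
Lemma subdifferential_separable_sum (R : realType) (X : lmodType R)
    (dot : {dot X for idfun}) (m : nat) (f : 'I_m -> X -> \bar R)
    (x u : {ffun 'I_m -> X}) :
  (forall i, subdifferential dot (f i) (x i) (u i)) ->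
  subdifferential (prod_dot dot) (separable_sum f) x u.
Proof.
move=> fxu z; rewrite /separable_sum /prod_dot -sumEFin -big_split /=.
by apply: lee_sum => i _; have := fxu i (z i); rewrite !ffunE.
Qed.

(** * Cyclic compositions of set-valued operators *)

(** Intermediate values are indexed by positions, with one more value than
    operators, because the chain need not be closed; when it is closed, the
    positions can be read modulo the number of operators. *)
Lemma foldl_comp_opP (V : zmodType) (K : Type) (P : K -> V -> set V)
    (k0 : K) (s : seq K) (z w : V) :
  foldl (fun A k => comp_op (P k) A) (op_of id) s z w <->
  exists a : nat -> V, [/\ a 0 = z, a (size s) = w &
    forall k, (k < size s)%N -> P (nth k0 s k) (a k) (a k.+1)].
Proof.
elim/last_ind: s w => [|s k IHs] w.
  split=> /= [->|[a [-> -> _]]] //.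
  by exists (fun=> z).
rewrite -cats1 foldl_cat /= size_cat addn1; split.
  move=> [v /IHs[a [a0 asz aP]] Pvw].
  exists (fun l => if (l <= size s)%N then a l else w); split=> //.
    by rewrite ltnn.
  move=> l; rewrite ltnS nth_cat /=; case: ltngtP => // [ls|->] _.
    exact: aP.
  by rewrite subnn asz.
move=> [a [a0 <- aP]]; exists (a (size s)).
  apply/IHs; exists a; split=> // l ls.
  by have := aP l (ltnW ls); rewrite nth_cat ls.
by have := aP _ (ltnSn _); rewrite nth_cat ltnn subnn.
Qed.

Lemma nth_rot_enum_ord (n : nat) (i : 'I_n.+1) (k : nat) :
  (k < n.+1)%N ->
  nth ord0 (rot i.+1 (enum 'I_n.+1)) k = inord ((i.+1 + k) %% n.+1).
Proof.
move=> kn; apply: val_inj; rewrite /= inordK ?ltn_pmod //.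
have i_lt := ltn_ord i.
rewrite /rot nth_cat size_drop size_enum_ord nth_drop.
case: ltnP => ki; first by rewrite nth_enum_ord ?modn_small //; lia.
rewrite nth_take; last by lia.
rewrite nth_enum_ord; last by lia.
have -> : (i.+1 + k = k - (n.+1 - i.+1) + n.+1)%N by lia.
by rewrite modnDr modn_small //; lia.
Qed.

Lemma ord_predE (n : nat) (i j : 'I_n.+1) : j = i.+1 :> nat -> i = ord_pred j.
Proof.
move=> ji; apply: val_inj; rewrite /= ji.
by rewrite addSn /= modnDr modn_small.
Qed.

Definition prox_cycle (R : realType) (X : lmodType R) (dot : {dot X for idfun})
    (m : nat) (f : 'I_m -> X -> \bar R) (x : {ffun 'I_m -> X}) : Prop :=
  forall k, prox dot (f k) (x (ord_pred k)) (x k).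

(** Closing up the chain of intermediate values of a fixed point gives a cycle
    that does not depend on where the composition starts. *)
Lemma cyclic_fixP (R : realType) (X : lmodType R) (dot : {dot X for idfun})
    (n : nat) (f : 'I_n.+1 -> X -> \bar R) (i : 'I_n.+1) (z : X) :
  cyclic_fix dot f i z <-> exists2 x, prox_cycle dot f x & x i = z.
Proof.
have i_lt := ltn_ord i.
rewrite /cyclic_fix /fix_op /cyclic_prox /= (foldl_comp_opP _ ord0).
rewrite size_rot size_enum_ord; split.
  move=> [a [a0 an aP]].
  (* The operator of index l sits at position (l - i - 1) mod n.+1 of the
     composition; the value attached to l is the one that it outputs. *)
  exists [ffun l : 'I_n.+1 => a ((l + (n - i)) %% n.+1).+1]; last first.
    by rewrite ffunE subnKC // modn_small.
  move=> l; rewrite !ffunE.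
  have l_lt := ltn_ord l.
  set k := ((l + (n - i)) %% n.+1)%N.
  have k_lt : (k < n.+1)%N by rewrite ltn_pmod.
  have := aP k k_lt; rewrite nth_rot_enum_ord //.
  have -> : inord ((i.+1 + k) %% n.+1) = l.
    apply: val_inj; rewrite /= inordK ?ltn_pmod // modnDmr.
    have -> : (i.+1 + (l + (n - i)) = l + n.+1)%N by lia.
    by rewrite modnDr modn_small.
  suff -> : a ((ord_pred l + (n - i)) %% n.+1).+1 = a k by [].
  rewrite /= addnS /= modnDml.
  have -> : (l + n + (n - i) = l + (n - i) + n)%N by lia.
  rewrite -modnDml -/k.
  case: (posnP k) => [->|k_gt0]; first by rewrite modn_small // an a0.
  have -> : (k + n = k.-1 + n.+1)%N by lia.
  by rewrite modnDr modn_small ?prednK //; lia.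
move=> [x xP xi].
exists (fun k => x (inord ((i + k) %% n.+1))).
rewrite addn0 modnDr modn_small // inord_val; split=> // k k_lt.
rewrite nth_rot_enum_ord // addSnnS.
have := xP (inord ((i + k.+1) %% n.+1)).
suff -> : ord_pred (inord ((i + k.+1) %% n.+1)) =
    inord ((i + k) %% n.+1) :> 'I_n.+1 by [].
apply: val_inj; rewrite /= !inordK ?ltn_pmod // addnS /= modnDml.
have -> : (i + k.+1 + n = i + k + n.+1)%N by lia.
by rewrite modnDr.
Qed.

(** The dual inclusion asks for two preimages of R x - x with sum 0: x under
    the subdifferential and - x under Id - R. *)
Lemma cycle_dual_solution (R : realType) (X : lmodType R)
    (dot : {dot X for idfun}) (m : nat) (f : 'I_m -> X -> \bar R)
    (x : {ffun 'I_m -> X}) :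
  prox_cycle dot f x -> dual_solutions dot f (rshift_op x - x).
Proof.
move=> xP; exists x.
  apply: subdifferential_separable_sum => i.
  by rewrite !ffunE; apply/proxE.
exists (- x); last by rewrite subrr.
by apply/ffunP => i; rewrite !ffunE opprK addrC.
Qed.

(** * One step along the cycles *)

Section unique_dual_solution.
Variables (R : realType) (X : lmodType R) (dot : {dot X for idfun}) (n : nat).
Variables (f : 'I_n.+1 -> X -> \bar R) (y : {ffun 'I_n.+1 -> X}).
Hypothesis f_proper : forall i, proper_ereal (f i).
Hypothesis y_unique : dual_solutions dot f = [set y].

Let F := cyclic_fix dot f.

(** All cycles have the same increments because R x - x is the unique dual
    solution y. *)
Lemma prox_cycle_step (x : {ffun 'I_n.+1 -> X}) (j : 'I_n.+1) :
  prox_cycle dot f x -> x j = x (ord_pred j) - y j.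
Proof.
move=> /cycle_dual_solution; rewrite y_unique => <-.
by rewrite !ffunE opprB addrC subrK.
Qed.

Lemma prox_cyclic_fix (j : 'I_n.+1) (z : X) :
  F (ord_pred j) z -> prox dot (f j) z = [set z - y j].
Proof.
move=> /cyclic_fixP[x xP <-].
have := xP j; rewrite (prox_cycle_step j xP) => prox_x.
apply/seteqP; split=> [p prox_p|_ ->] //.
exact: prox_unique prox_p prox_x.
Qed.

Lemma cyclic_fix_translate (j : 'I_n.+1) :
  F j = translate (F (ord_pred j)) (- y j).
Proof.
apply/seteqP; split=> [_ /cyclic_fixP[x xP <-]|].
  exists (x (ord_pred j)); first by apply/cyclic_fixP; exists x.
  by rewrite (prox_cycle_step j xP).
move=> _ [_ /cyclic_fixP[x xP <-] <-]; apply/cyclic_fixP; exists x => //.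
exact: prox_cycle_step.
Qed.

Lemma prox_cyclic_fix_bij (j : 'I_n.+1) :
  bij_op (prox dot (f j)) (F (ord_pred j)) (F j).
Proof.
exists (fun z => z - y j); first exact: prox_cyclic_fix.
rewrite (cyclic_fix_translate j); split.
- by move=> z Fz; exists z.
- by move=> z z' _ _; apply: addIr.
- by [].
Qed.

Lemma cyclic_fix_translate_ord0 (i : 'I_n.+1) :
  exists v : X, F i = translate (F ord0) v.
Proof.
case: i => k; elim: k => [|k IHk] k_lt.
  exists 0; rewrite (_ : Ordinal k_lt = ord0); last exact: val_inj.
  by apply/seteqP; split=> [z Fz|_ [z Fz <-]]; [exists z|]; rewrite ?addr0.
have [v Fv] := IHk (ltnW k_lt).
exists (v - y (Ordinal k_lt)).
rewrite cyclic_fix_translate -(@ord_predE _ (Ordinal (ltnW k_lt))) // Fv.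
apply/seteqP; split=> [_ [_ [z Fz <-] <-]|_ [z Fz <-]].
  by exists z => //; rewrite addrA.
by exists (z + v); [exists z|rewrite addrA].
Qed.

End unique_dual_solution.

(* There are n.+1 functions; ord0 and ord_max are the indices 1 and m. *)
Theorem corollary3p5 (R : realType) (X : completeNormedModType R)
    (dot : {dot X for idfun}) (n : nat) (f : 'I_n.+1 -> X -> \bar R)
    (y : {ffun 'I_n.+1 -> X})
    (hilbert : norm_of_dot dot)
    (f_proper : forall i, proper_ereal (f i))
    (f_lsc : forall i, lower_semicontinuous (f i))
    (f_convex : forall i, convex_ereal (f i))
    (standing : edom (fenchel_conjugate (prod_dot dot) (separable_sum f))
                  `&` orthogonal_compl (prod_dot dot) (diagonal_space (X := X) (m := n.+1)) !=set0)
    (y_unique : dual_solutions dot f = [set y]) :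
  let F := cyclic_fix dot f in
  ((forall i j : 'I_n.+1, j = i.+1 :> nat ->
      bij_op (prox dot (f j)) (F i) (F j) /\
      (forall z, F i z -> prox dot (f j) z = [set z - y j])) /\
   (bij_op (prox dot (f ord0)) (F ord_max) (F ord0) /\
    (forall z, F ord_max z -> prox dot (f ord0) z = [set z - y ord0]))) /\
  ((forall i j : 'I_n.+1, j = i.+1 :> nat -> F j = translate (F i) (- y j)) /\
   F ord0 = translate (F ord_max) (- y ord0) /\
   (forall i : 'I_n.+1, exists v : X, F i = translate (F ord0) v)).
Proof.
move=> F.
have pred0 : ord_max = ord_pred ord0 :> 'I_n.+1.
  by apply: val_inj; rewrite /= modn_small.
split; split.
- move=> i j /ord_predE ->; split; first exact: (prox_cyclic_fix_bij f_proper y_unique).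
  by move=> z; apply: prox_cyclic_fix.
- rewrite pred0; split; first exact: (prox_cyclic_fix_bij f_proper y_unique).
  by move=> z; apply: prox_cyclic_fix.
- by move=> i j /ord_predE ->; apply: cyclic_fix_translate.
- split; first by rewrite pred0; apply: cyclic_fix_translate.
  exact: (cyclic_fix_translate_ord0 y_unique).
Qed.
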